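(* Let $\{a_0,a_1,\ldots\}$ and $\{b_1,b_2,\ldots\}$ be complex sequences with all $a_i\neq 0$, and let $f=(f_0,f_1,\ldots)$ be a complex sequence. The solution $u^f_{n,t}$ of $$\begin{cases} u_{n,t+1}+u_{n,t-1}-a_n u_{n+1,t}-a_{n-1}u_{n-1,t}-b_n u_{n,t}=0,& n\in\mathbb{N},\ t\in\mathbb{N}\cup\{0\},\\ u_{n,-1}=u_{n,0}=0,& n\in\mathbb{N},\\ u_{0,t}=f_t,& t\in\mathbb{N}\cup\{0\},\end{cases}$$ admits the representation $$u^f_{n,t}=\left(\prod_{k=0}^{n-1}a_k\right)f_{t-n}+\sum_{s=n}^{t-1}w_{n,s}f_{t-s-1},\qquad n,t\in\mathbb{N},$$ where $w_{n,s}$ satisfies the Goursat problem $$\begin{cases} w_{n,s+1}+w_{n,s-1}-a_nw_{n+1,s}-a_{n-1}w_{n-1,s}-b_nw_{n,s}=-\delta_{s,n}(1-a_n^2)\prod_{k=0}^{n-1}a_k,& n,s\in\mathbb{N},\ s\geq n,\\ w_{n,n}-b_n\prod_{k=0}^{n-1}a_k-a_{n-1}w_{n-1,n-1}=0,& n\in\mathbb{N},\\ w_{0,t}=0,& t\in\mathbb{N}\cup\{0\}.\end{cases}$$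
   Context: $\mathbb{N}=\{1,2,\ldots\}$; $\delta_{s,n}$ is the Kronecker delta. Conventions: $f_t=0$ for $t<0$; $w_{n,s}=0$ for $n>s$; a sum whose lower limit exceeds its upper limit is zero. *)

(* Defs.v *)
(* The field of complex numbers is [R[i]] for a [realType] R. *)
From mathcomp Require Import all_boot all_order all_algebra.
From mathcomp Require Import reals complex.

Set Implicit Arguments.
Unset Strict Implicit.
Unset Printing Implicit Defensive.

Import Order.TTheory GRing.Theory Num.Theory.
Local Open Scope ring_scope.

(* The convention f_t = 0 for t < 0. *)
Definition ext0 (R : realType) (f : nat -> R[i]) (t : int) : R[i] :=
  if t is Posz m then f m else 0.

(* Time is an [int] because of the initial value at t = -1.  Only b_n with
   n >= 1 occurs, so [b 0%N] is irrelevant. *)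
Definition wave_solution (R : realType) (a b f : nat -> R[i])
    (u : nat -> int -> R[i]) : Prop :=
  [/\ forall n t : nat, (0 < n)%N ->
        u n (t%:Z + 1) + u n (t%:Z - 1) - a n * u n.+1 t%:Z
          - a n.-1 * u n.-1 t%:Z - b n * u n t%:Z = 0,
      forall n : nat, (0 < n)%N -> u n (-1) = 0 /\ u n 0 = 0
    & forall t : nat, u 0%N t%:Z = f t].

(* The last clause is the convention w_{n,s} = 0 for n > s; the predecessors
   are genuine since n, s >= 1 wherever they occur. *)
Definition goursat_solution (R : realType) (a b : nat -> R[i])
    (w : nat -> nat -> R[i]) : Prop :=
  [/\ forall n s : nat, (0 < n)%N -> (0 < s)%N -> (n <= s)%N ->
        w n s.+1 + w n s.-1 - a n * w n.+1 s - a n.-1 * w n.-1 s - b n * w n s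
        = - ((s == n)%:R * (1 - a n ^+ 2) * \prod_(0 <= k < n) a k),
      forall n : nat, (0 < n)%N ->
        w n n - b n * \prod_(0 <= k < n) a k - a n.-1 * w n.-1 n.-1 = 0,
      forall t : nat, w 0%N t = 0
    & forall n s : nat, (s < n)%N -> w n s = 0].

(* Main.v *)
(* Let G be the solution with boundary data f = delta_0.  Since the system has
   coefficients independent of t, Duhamel's principle gives
   u^f_{n,t} = sum_s G_{n,s} f_{t-s}.  Finite speed of propagation makes G_{n,s}
   vanish for s < n, on the front s = n it equals a_0 ... a_{n-1}, and its
   values behind the front, w_{n,s} = G_{n,s+1} for s >= n, are the Goursat
   kernel; the front values produce the right-hand side of the Goursat
   problem. *)
Require Import Defs.
From mathcomp Require Import all_boot all_order all_algebra.
From mathcomp Require Import reals complex.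
From mathcomp Require Import ring zify.
Import Order.TTheory GRing.Theory Num.Theory.
Local Open Scope ring_scope.

(* [s.-1] is [0] at [s = 0], where [green a b 0 n = 0] for [n > 0], which agrees
   with the initial value at time -1. *)
Fixpoint green {K : comNzRingType} (a b : nat -> K) (t n : nat) {struct t} : K :=
  match t with
  | 0 => (n == 0%N)%:R
  | s.+1 => if n is m.+1 then
              a n * green a b s n.+1 + a m * green a b s m + b n * green a b s n
              - green a b s.-1 n
            else 0
  end.

Arguments green : simpl never.

Definition front {K : comNzRingType} (a : nat -> K) (n : nat) : K :=
  \prod_(0 <= k < n) a k.

(** The test [n <= s] changes a value only at [s.+1 = n], where it removes the front value; for
    [s.+1 < n] the Green function is already zero. *)
Definition goursat_kernel {K : comNzRingType} (a b : nat -> K) (n s : nat) : K :=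
  if (n <= s)%N then green a b s.+1 n else 0.

Section Green.
Context {K : comNzRingType} (a b : nat -> K).

Local Notation G n s := (green a b s n).

Lemma green0n s : G 0 s = (s == 0%N)%:R. Proof. by case: s. Qed.

Lemma greenn0 n : G n 0 = (n == 0%N)%:R. Proof. by []. Qed.

Lemma green_step n s : (0 < n)%N ->
  G n s.+1 = a n * G n.+1 s + a n.-1 * G n.-1 s + b n * G n s - G n s.-1.
Proof. by case: n. Qed.

Lemma frontS n : front a n.+1 = a n * front a n.
Proof. by rewrite /front big_nat_recr //= mulrC. Qed.

Lemma green_lt n s : (s < n)%N -> G n s = 0.
Proof.
elim/ltn_ind: s n => -[|s] IH n lt_sn; first by case: n lt_sn.
rewrite green_step ?(leq_trans _ lt_sn) // !IH; try lia.
by ring.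
Qed.

Lemma green_diag n : G n n = front a n.
Proof.
elim: n => [|n IH]; first by rewrite /front big_geq.
rewrite green_step //= IH frontS !green_lt; try lia.
by ring.
Qed.

(** One step behind the front, two of the four terms of the recursion lie ahead of the front and
    vanish. *)
Lemma goursat_kernel_diag n : (0 < n)%N ->
  goursat_kernel a b n n - b n * front a n
  - a n.-1 * goursat_kernel a b n.-1 n.-1 = 0.
Proof.
case: n => [//|n] _; rewrite /goursat_kernel !leqnn green_step //=.
by rewrite -green_diag [G n.+2 _]green_lt // [G n.+1 n]green_lt //; ring.
Qed.

(** For [s > n] this is the Green recursion. For [s = n] the kernel drops the front values at [n]
    and [n.+1], which the recursion contains; their contribution [front a n - a n * front a n.+1] is
    the source term. *)
Lemma goursat_kernel_step n s : (0 < n)%N -> (0 < s)%N -> (n <= s)%N ->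
  goursat_kernel a b n s.+1 + goursat_kernel a b n s.-1
  - a n * goursat_kernel a b n.+1 s - a n.-1 * goursat_kernel a b n.-1 s
  - b n * goursat_kernel a b n s
  = - ((s == n)%:R * (1 - a n ^+ 2) * front a n).
Proof.
move=> n0 s0 le_ns; rewrite /goursat_kernel le_ns leqW // green_step //.
have -> : (n.-1 <= s)%N by lia.
have [-> | ne_sn] := eqVneq s n.
  rewrite ltnn ifF; last by lia.
  by rewrite /= !green_diag frontS; ring.
rewrite ifT; last by lia.
rewrite ifT; last by lia.
by rewrite prednK //=; ring.
Qed.

End Green.

Section Duhamel.
Context {R : realType} (a b : nat -> R[i]).

Local Notation G n s := (green a b s n).

Lemma ext0_lt0 (f : nat -> R[i]) (t : int) : t < 0 -> ext0 f t = 0.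
Proof. by case: t. Qed.

Definition duhamel (f : nat -> R[i]) (n : nat) (t : int) : R[i] :=
  \sum_(0 <= s < (absz t).+1) G n s * ext0 f (t - s%:Z).

(** Sums at different times can thus be brought to a common range. *)
Lemma duhamel_widen f n t N : t < N%:Z ->
  duhamel f n t = \sum_(0 <= s < N) G n s * ext0 f (t - s%:Z).
Proof.
have widen M N' : t < M%:Z -> (M <= N')%N ->
    \sum_(0 <= s < N') G n s * ext0 f (t - s%:Z)
    = \sum_(0 <= s < M) G n s * ext0 f (t - s%:Z).
  move=> lt_tM le_MN; rewrite (big_cat_nat (n := M)) //=.
  rewrite [X in _ + X]big_nat_cond [X in _ + X]big1 ?addr0 // => s.
  by move=> /andP[/andP[le_Ms _] _]; rewrite ext0_lt0 ?mulr0 //; lia.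
move=> lt_tN; rewrite /duhamel.
by case: (leqP N (absz t).+1) => h; [|symmetry]; apply: widen => //; lia.
Qed.

Lemma duhamel_solution f : wave_solution a b f (duhamel f).
Proof.
split=> [n t n0|n n0|t].
(* The bounds are chosen so that, once the zero term [G n 0] is split off or added by a shift of
   [s], every sum runs over [s < t.+2] and [green_step] applies termwise. *)
- rewrite (@duhamel_widen f n (t%:Z + 1) t.+3); last by lia.
  rewrite (@duhamel_widen f n (t%:Z - 1) t.+1); last by lia.
  rewrite !(@duhamel_widen f _ t%:Z t.+2); try lia.
  rewrite big_nat_recl // greenn0 (gtn_eqF n0) mul0r add0r.
  have -> : \sum_(0 <= s < t.+1) G n s * ext0 f (t%:Z - 1 - s%:Z)
            = \sum_(0 <= s < t.+2) G n s.-1 * ext0 f (t%:Z - s%:Z).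
    rewrite [RHS]big_nat_recl // greenn0 (gtn_eqF n0) mul0r add0r.
    by apply: eq_bigr => s _ /=; congr (_ * ext0 f _); lia.
  rewrite !mulr_sumr -big_split -!sumrB big1 // => s _ /=.
  rewrite green_step //.
  have -> : t%:Z + 1 - s.+1%:Z = t%:Z - s%:Z by lia.
  by ring.
- split; rewrite (@duhamel_widen f n _ 1) // big_nat1 greenn0.
    by rewrite (gtn_eqF n0) mul0r.
  by rewrite (gtn_eqF n0) mul0r.
- rewrite (@duhamel_widen f _ _ t.+1); last by lia.
  rewrite big_nat_recl // subr0 mul1r.
  by rewrite big1 ?addr0 // => s _; rewrite green0n mul0r.
Qed.

Lemma duhamel_goursat f n t :
  duhamel f n t%:Z = front a n * ext0 f (t%:Z - n%:Z)
    + \sum_(n <= s < t) goursat_kernel a b n s * ext0 f (t%:Z - s%:Z - 1).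
Proof.
(* [N] exceeds [n] as well, so that the front term is present even when [t < n]. *)
have split_front N : (n < N)%N -> (t < N)%N ->
    duhamel f n t%:Z = front a n * ext0 f (t%:Z - n%:Z)
      + \sum_(n.+1 <= s < N) G n s * ext0 f (t%:Z - s%:Z).
  move=> lt_nN lt_tN; rewrite (@duhamel_widen f n t N); last by lia.
  rewrite (big_cat_nat (n := n)) //=; last by lia.
  rewrite big_nat_cond big1 ?add0r => [|s /andP[/andP[_ lt_sn] _]].
    by rewrite big_ltn // green_diag.
  by rewrite green_lt ?mul0r.
have [le_tn | lt_nt] := leqP t n.
  by rewrite (split_front n.+1) // !big_geq.
rewrite (split_front t.+1) //; last by lia.
rewrite big_add1 /=; congr (_ + _); apply: eq_big_nat => s /andP[le_ns _].
by rewrite /goursat_kernel le_ns; congr (_ * ext0 f _); lia.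
Qed.

(** The equation is second order in time, so the induction carries two consecutive times; at [n = 0]
    the earlier one is left out, since [u 0 (-1)] is not prescribed. *)
Lemma wave_solution_unique {f u v} : wave_solution a b f u -> wave_solution a b f v ->
  forall n t : nat, u n t%:Z = v n t%:Z.
Proof.
move=> [u_step u_init u_bd] [v_step v_init v_bd].
have agree (t n : nat) : u n t%:Z = v n t%:Z
    /\ ((0 < n)%N -> u n (t%:Z - 1) = v n (t%:Z - 1)).
  elim: t n => [|t IH] [|n]; rewrite ?u_bd ?v_bd //.
    have [-> ->] := u_init n.+1 isT; have [-> ->] := v_init n.+1 isT.
    by split.
  have -> : t.+1%:Z = t%:Z + 1 by lia.
  rewrite addrK; have [eq_t eq_t1] := IH n.+1; split=> //.
  have := u_step n.+1 t isT; rewrite -(v_step n.+1 t isT) eq_t eq_t1 //.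
  by rewrite (IH n.+2).1 (IH n).1 => /addIr/addIr/addIr/addIr.
by move=> n t; case: (agree t n).
Qed.

End Duhamel.

Theorem lemma1 (R : realType) (a b : nat -> R[i]) (ha : forall i : nat, a i != 0) :
  exists w : nat -> nat -> R[i],
    goursat_solution a b w /\
    forall f : nat -> R[i],
      (exists u : nat -> int -> R[i], wave_solution a b f u) /\
      forall u : nat -> int -> R[i], wave_solution a b f u ->
        forall n t : nat, (0 < n)%N -> (0 < t)%N ->
          u n t%:Z = (\prod_(0 <= k < n) a k) * ext0 f (t%:Z - n%:Z)
                     + \sum_(n <= s < t) w n s * ext0 f (t%:Z - s%:Z - 1).
Proof.
exists (goursat_kernel a b); split.
  split=> [n s|n|t|n s lt_sn]; first exact: goursat_kernel_step.
  - exact: goursat_kernel_diag.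
  - by [].
  - by rewrite /goursat_kernel leqNgt lt_sn.
move=> f; split=> [|u u_sol n t _ _].
  by exists (duhamel a b f); apply: duhamel_solution.
by rewrite (wave_solution_unique _ _ u_sol (duhamel_solution _ _ f)) duhamel_goursat.
Qed.
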